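(* Let $q\ge 2$, $n$ and $k$ be integers with $1<k<n/2$. The maximum number of words in a code $C\subseteq\Sigma^n$, $|\Sigma|=q$, that is simultaneously $(1,k)$-overlap-free and $(n-k,n-1)$-overlap-free is at least $$\left\lfloor\frac{qk}{k+2}\right\rfloor^{k}\left(q-\left\lfloor\frac{qk}{k+2}\right\rfloor\right)^{2}q^{\,n-k-2}.$$
   Context: Let $\Sigma$ be a finite alphabet with $q\ge 2$ letters. Two (not necessarily distinct) words $u,v$ over $\Sigma$ have a $t$-overlap if the prefix of $u$ of length $t$ equals the suffix of $v$ of length $t$, or vice versa. A code $C\subseteq\Sigma^n$ is $(t_1,t_2)$-overlap-free if for all $t_1\le t\le t_2$ no two (not necessarily distinct) codewords in $C$ have a $t$-overlap. *)

(* Defs.v *)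
From mathcomp Require Import all_boot.

Set Implicit Arguments.
Unset Strict Implicit.
Unset Printing Implicit Defensive.

Definition word_prefix (S : Type) (t : nat) (u : seq S) : seq S := take t u.

Definition word_suffix (S : Type) (t : nat) (u : seq S) : seq S :=
  drop (size u - t) u.

(* A word has a prefix or suffix of length t only when t <= size; take and
   drop would otherwise return the whole word, hence the two guards. *)
Definition has_overlap (S : eqType) (t : nat) (u v : seq S) : bool :=
  [&& t <= size u, t <= size v &
      (word_prefix t u == word_suffix t v) ||
      (word_prefix t v == word_suffix t u)].

Definition overlap_free (S : finType) (n t1 t2 : nat)
    (C : {set n.-tuple S}) : bool :=
  [forall u in C, forall v in C, forall t : 'I_t2.+1,
     (t1 <= t) ==> ~~ has_overlap t u v].

(* The empty code is always admissible, so this is a genuine maximum. *)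
Definition max_code_size (S : finType) (n k : nat) : nat :=
  \max_(C : {set n.-tuple S} |
        overlap_free 1 k C && overlap_free (n - k) (n - 1) C) #|C|.

(* Main.v *)
Require Import Defs.
From mathcomp Require Import all_boot.
From mathcomp Require Import zify.

(** Fix a set A of letters with |A| = floor(qk/(k+2)) and take all words whose
    first k letters lie in A and whose (k+1)-st and last letters do not. An
    overlap of length at most k would put the last letter of one word among the
    first k letters of another; an overlap of length n - s with 1 <= s <= k would
    identify the (k+1)-st letter of one word with the (k+1-s)-th letter of
    another. *)

(** The family [P] is indexed by [nat] rather than ['I_n], so that products of its cardinals can be
    split over integer ranges. *)
Definition boxed (S : finType) (n : nat) (P : nat -> {set S}) :
    {set n.-tuple S} :=
  [set w | [forall i : 'I_n, tnth w i \in P i]].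

Lemma card_boxed (S : finType) (n : nat) (P : nat -> {set S}) :
  #|boxed S n P| = \prod_(0 <= i < n) #|P i|.
Proof.
(* The count is known for families of finite functions; [tup] carries it over to words. *)
pose tup (f : {ffun 'I_n -> S}) := [tuple f i | i < n].
have tup_inj : injective tup.
  move=> f g eq_fg; apply/ffunP => i.
  by have := congr1 (fun w => tnth w i) eq_fg; rewrite !tnth_mktuple.
have -> : boxed S n P = tup @: family (fun i : 'I_n => mem (P i)).
  apply/setP => w; rewrite inE; apply/forallP/imsetP => [wP | [f fP ->] i].
    exists [ffun i => tnth w i]; first by apply/familyP => i; rewrite ffunE.
    by apply: eq_from_tnth => i; rewrite tnth_mktuple ffunE.
  by rewrite tnth_mktuple; apply: (familyP fP).
by rewrite card_imset // card_family foldrE big_image big_mkord.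
Qed.

(** Positions count from 0: [k] is the (k+1)-st letter and [n.-1] the last. *)
Definition letters_at (S : finType) (n k : nat) (A : {set S}) (i : nat) :
    {set S} :=
  if i < k then A else if (i == k) || (i == n.-1) then ~: A else [set: S].

Lemma prod_card_letters_at (S : finType) (n k : nat) (A : {set S}) :
  k.+1 < n ->
  \prod_(0 <= i < n) #|letters_at S n k A i|
    = #|A| ^ k * #|~: A| ^ 2 * #|S| ^ (n - k - 2).
Proof.
(* This form of [n] shows the four blocks: [k] letters, position [k], the free letters, the last
   letter. *)
move=> ltkn; have -> : n = (k.+1 + (n - k - 2)).+1 by lia.
set r := n - k - 2; have -> : (k.+1 + r).+1 - k - 2 = r by lia.
rewrite big_nat_recr //= (big_cat_nat _ (n := k.+1)) ?leq_addr //=.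
rewrite big_nat_recr //=.
have -> : \prod_(0 <= i < k) #|letters_at S (k.+1 + r).+1 k A i| = #|A| ^ k.
  rewrite (eq_big_nat _ _ (F2 := fun=> #|A|)) ?prod_nat_const_nat ?subn0 //.
  by move=> i /andP[_ lt_ik]; rewrite /letters_at lt_ik.
have -> : \prod_(k.+1 <= i < k.+1 + r) #|letters_at S (k.+1 + r).+1 k A i|
    = #|S| ^ r.
  rewrite (eq_big_nat _ _ (F2 := fun=> #|S|)) ?prod_nat_const_nat ?addKn //.
  move=> i lt_i; rewrite -cardsT /letters_at.
  by do 2 (rewrite ifF; last by lia).
rewrite /letters_at ltnn !eqxx orbT ifF; last by lia.
by rewrite -mulnn !mulnA mulnAC.
Qed.

Lemma tuple_nth_boxed (S : finType) (n : nat) (P : nat -> {set S})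
    (x : S) (w : n.-tuple S) (i : nat) :
  w \in boxed S n P -> i < n -> nth x w i \in P i.
Proof.
rewrite inE => /forallP wP lt_in.
by have := wP (Ordinal lt_in); rewrite (tnth_nth x).
Qed.

Lemma prefix_neq_suffix (S : finType) (n k t : nat) (A : {set S})
    (u v : n.-tuple S) :
  2 * k < n -> u \in boxed S n (letters_at S n k A) ->
  v \in boxed S n (letters_at S n k A) ->
  0 < t < n -> (t <= k) || (n - k <= t) ->
  word_prefix t u != word_suffix t v.
Proof.
move=> ltkn uC vC /andP[t_gt0 lt_tn] t_range; apply/eqP => eq_uv.
pose x := tnth u (Ordinal lt_tn).
have eq_nth i : i < t -> nth x u i = nth x v (n - t + i).
  move=> lt_it; rewrite -(nth_take x lt_it) -/(word_prefix t u) eq_uv.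
  by rewrite /word_suffix size_tuple nth_drop.
(* Position [i] of [u] meets position [n - t + i] of [v], so one letter would lie both in [A] and in
   its complement. *)
have clash i : i < t -> i < k ->
    (n - t + i == k) || (n - t + i == n.-1) -> n - t + i >= k -> False.
  move=> lt_it lt_ik at_j le_kj.
  have := tuple_nth_boxed _ _ _ x _ i uC (ltn_trans lt_it lt_tn).
  have lt_jn : n - t + i < n by lia.
  have := tuple_nth_boxed _ _ _ x _ _ vC lt_jn.
  by rewrite /letters_at lt_ik ltnNge le_kj at_j /= -eq_nth // inE => /negP.
case/orP: t_range => [le_tk | le_t].
  (* The last letter of the prefix meets the last letter of [v]. *)
  by apply: (clash t.-1); lia.
(* With shift [s = n - t], where [0 < s <= k], position [k - s] of [u] meets position [k] of [v]. *)
by apply: (clash (k - (n - t))); lia.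
Qed.

(** The bounds [t1], [t2] stay abstract so that both the short and the long range are instances. *)
Lemma overlap_free_boxed (S : finType) (n k t1 t2 : nat) (A : {set S}) :
  2 * k < n ->
  (forall t, t1 <= t <= t2 -> (0 < t < n) && ((t <= k) || (n - k <= t))) ->
  overlap_free t1 t2 (boxed S n (letters_at S n k A)).
Proof.
move=> ltkn t_range; apply/forall_inP => u uC; apply/forall_inP => v vC.
apply/forallP => t; apply/implyP => le_t.
have /andP[t_bounds t_k] : (0 < t < n) && ((t <= k) || (n - k <= t)).
  by apply: t_range; rewrite le_t -ltnS ltn_ord.
have neq x y := prefix_neq_suffix S n k t A x y ltkn.
rewrite /has_overlap (negPf (neq u v uC vC t_bounds t_k)).
by rewrite (negPf (neq v u vC uC t_bounds t_k)) !andbF.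
Qed.

Lemma exists_set_card (S : finType) (m : nat) :
  m <= #|S| -> exists A : {set S}, #|A| = m.
Proof.
move=> le_mS; exists [set x in take m (enum S)].
by rewrite cardsE (card_uniqP _) ?take_uniq ?enum_uniq // size_takel // -cardE.
Qed.

Theorem proposition12 (q n k : nat) (Sigma : finType) (hq : 2 <= q)
    (hSigma : #|Sigma| = q) (hk : 1 < k) (hkn : 2 * k < n) :
  (q * k %/ (k + 2)) ^ k * (q - q * k %/ (k + 2)) ^ 2 * q ^ (n - k - 2)
    <= max_code_size Sigma n k.
Proof.
set m := q * k %/ (k + 2).
have le_mS : m <= #|Sigma|.
  (* Writing [q] as [q * (k + 2) %/ (k + 2)] reduces the bound to monotonicity of division. *)
  rewrite hSigma -[leqRHS](@mulnK _ (k + 2)) ?addn2 //.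
  by rewrite /m addn2 leq_div2r // leq_mul2l ltnW ?orbT.
have [A cardA] := exists_set_card _ _ le_mS.
have cardCA : #|~: A| = q - m by rewrite cardsCs setCK cardA hSigma.
have <- : #|boxed Sigma n (letters_at Sigma n k A)|
    = m ^ k * (q - m) ^ 2 * q ^ (n - k - 2).
  have lt_kn : k.+1 < n by clear -hk hkn; lia.
  by rewrite card_boxed prod_card_letters_at // cardA cardCA hSigma.
rewrite /max_code_size.
apply: (leq_bigmax_cond (F := fun C : {set n.-tuple Sigma} => #|C|)).
by apply/andP; split; apply: overlap_free_boxed => // t; clear -hk hkn; lia.
Qed.
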